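(* Let $i\in\{1,\ldots,N\}$ and $M>0$. Suppose that, for all $j\in\{1,\ldots,N\}$, the set $X_j\subset\mathbb{R}^{n_j}$ is non-empty, convex and compact, $f_j:\mathbb{R}^{n_j}\to\mathbb{R}$ and $g_j:\mathbb{R}^{n_j}\to\mathbb{R}$ are convex; that there exist $\bar x_1\in X_1,\ldots,\bar x_N\in X_N$ with $\sum_{j=1}^N g_j(\bar x_j)<b$, where $b\in\mathbb{R}$; and that for each $j$ the estimated functions $\{f_j^t\}_{t\in\mathbb{N}}$ converge to $f_j$ uniformly on $X_j$. Let $p_i$ be the primal function and ${p_i^t}'$ the (tie-broken) subderivative function of the estimated primal function, as defined in the context. Then there exists a sequence $\{\epsilon_i^t\}_{t\in\mathbb{N}}$ of non-negative scalars such that for all $t\in\mathbb{N}$ and $y_i\in\mathbb{R}$ $$p_i(z)\ \ge\ p_i(y_i)+(z-y_i)\,{p_i^t}'(y_i)-\epsilon_i^t\qquad\forall\, z\in\mathbb{R}.$$ Moreover, $\lim_{t\to\infty}\epsilon_i^t=0$.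
   Context: Primal function: for $y_i\in\mathbb{R}$, $$p_i(y_i)=\min_{x_i,\rho_i}\ f_i(x_i)+M\rho_i\quad\text{subject to}\quad g_i(x_i)\le y_i+\rho_i,\ x_i\in X_i,\ \rho_i\ge0.$$ Estimated primal function $p_i^t(y_i)$: the same, with $f_i$ replaced by the real-valued estimated function $f_i^t$. Its dual function is, for $\mu_i\le M$, $$q_i^t(\mu_i,y_i)=\min_{x_i\in X_i}\big[f_i^t(x_i)+\mu_i(g_i(x_i)-y_i)\big]$$ (and $-\infty$ for $\mu_i>M$). The selected multiplier is the smallest maximizer $$\mu_i^t(y_i)=\min\Big\{\operatorname{argmax}_{0\le\mu_i\le M} q_i^t(\mu_i,y_i)\Big\},$$ and the subderivative function of the estimated primal function is defined as ${p_i^t}'(y_i)=-\mu_i^t(y_i)$. It is implicit that the minima involving $f_i^t$ exist. *)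

(* Defs.v *)
From mathcomp Require Import all_boot all_order all_algebra.
From mathcomp Require Import all_classical all_reals all_analysis.

Set Implicit Arguments.
Unset Strict Implicit.
Unset Printing Implicit Defensive.

Import Order.TTheory GRing.Theory Num.Theory.
Import numFieldNormedType.Exports.

Local Open Scope classical_set_scope.
Local Open Scope ring_scope.

Definition minimums (R : realType) (A : set R) : set R := A `&` lbound A.

Definition has_minimum (R : realType) (A : set R) : Prop :=
  minimums A !=set0.

(* An attained minimum, not an infimum: the default value 0 is returned when
   A has no least element, even if A is bounded below. *)
Definition minimum (R : realType) (A : set R) : R := xget 0 (minimums A).

Definition argmax (R : realType) (D : set R) (q : R -> \bar R) : set R :=
  [set mu | D mu /\ forall nu, D nu -> (q nu <= q mu)%E].

(* x.1 is the decision variable and x.2 the violation rho. *)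
Definition primal_values (R : realType) (n : nat) (X : set 'rV[R]_n)
    (g : 'rV[R]_n -> R) (M : R) (f : 'rV[R]_n -> R) (y : R) : set R :=
  [set f x.1 + M * x.2 | x in
    [set x : 'rV[R]_n * R | [/\ g x.1 <= y + x.2, X x.1 & 0 <= x.2]]].

Definition primal (R : realType) (n : nat) (X : set 'rV[R]_n)
    (g : 'rV[R]_n -> R) (M : R) (f : 'rV[R]_n -> R) (y : R) : R :=
  minimum (primal_values X g M f y).

Definition dual_values (R : realType) (n : nat) (X : set 'rV[R]_n)
    (g : 'rV[R]_n -> R) (f : 'rV[R]_n -> R) (mu y : R) : set R :=
  [set f x + mu * (g x - y) | x in X].

Definition dual (R : realType) (n : nat) (X : set 'rV[R]_n)
    (g : 'rV[R]_n -> R) (M : R) (f : 'rV[R]_n -> R) (mu y : R) : \bar R :=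
  if mu <= M then (minimum (dual_values X g f mu y))%:E else -oo%E.

Definition multiplier (R : realType) (n : nat) (X : set 'rV[R]_n)
    (g : 'rV[R]_n -> R) (M : R) (f : 'rV[R]_n -> R) (y : R) : R :=
  minimum (argmax `[0, M] (fun mu => dual X g M f mu y)).

(* A selection of a subgradient of the primal function obtained from the dual
   problem, ties being broken towards the smallest multiplier; the primal
   function itself does not occur. *)
Definition subderivative (R : realType) (n : nat) (X : set 'rV[R]_n)
    (g : 'rV[R]_n -> R) (M : R) (f : 'rV[R]_n -> R) (y : R) : R :=
  - multiplier X g M f y.

(* Main.v *)
Require Import Defs.
From mathcomp Require Import all_boot all_order all_algebra.
From mathcomp Require Import all_classical all_reals all_analysis.
From mathcomp Require Import ring lra.

Set Implicit Arguments.
Unset Strict Implicit.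
Unset Printing Implicit Defensive.

Import Order.TTheory GRing.Theory Num.Theory.
Import numFieldNormedType.Exports.

Local Open Scope classical_set_scope.
Local Open Scope ring_scope.

(** Write q and q' for the dual functions of f and of an estimate f', and mu for
    the selected multiplier at y, a maximizer over [0, M] of q' at y.  An
    estimate may fail to be convex, so strong duality is available for f only.

    If |f' - f| <= d on X, then |q' - q| <= d, hence
    p(y) = max q(., y) <= max q'(., y) + d = q'(mu, y) + d <= q(mu, y) + 2d,
    whereas weak duality gives p(z) >= q(mu, z) = q(mu, y) - mu (z - y).  So the
    subgradient inequality at y with slope - mu fails by at most 2d
    (subgradient_gap_le).  Strong duality for f is penalty_multiplier, where the
    multiplier is the least one that the infeasible points allow.

    Uniform convergence says nothing about the first few estimates, which may
    be unbounded on X, yet the error has to be finite for them too.  It is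
    bounded for every estimate (subgradient_gap_bounded): once y leaves the
    range of g on X, the terms g x - y all have the same sign and mu is
    forced to be 0 or M, which is the slope of p there up to sign.  The error of
    index t is then the supremum over all y and z of the failure of the
    subgradient inequality.

    The minima and maxima have to be attained, since an unattained minimum has
    the default value 0.  For p, a convex function on R^n is continuous
    (convex_continuous) and X is compact; for the multiplier, q' is Lipschitz in
    mu and its maximizers form a closed set (multiplierP). *)

Lemma minimumP (R : realType) (A : set R) :
  has_minimum A -> A (minimum A) /\ forall a, A a -> minimum A <= a.
Proof. by move=> /(@xgetPex _ 0 (minimums A))[? lbA]; split=> // a /lbA. Qed.

(** * Continuity of convex functions on R^n *)

Lemma convex_function_le (R : realType) (V : lmodType R) (f : V -> R) (x y : V)
    (s : R) :
  @convex_function R V setT f -> 0 <= s -> s <= 1 ->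
  f (s *: x + (1 - s) *: y) <= s * f x + (1 - s) * f y.
Proof.
move=> cf s0 s1; have := cf (Itv01 s0 s1) x y.
by rewrite !in_setT => /(_ isT isT).
Qed.

Lemma convex_midpoint_le (R : realType) (V : lmodType R) (f : V -> R)
    (x y : V) :
  @convex_function R V setT f -> f (2^-1 *: (x + y)) <= (f x + f y) / 2.
Proof.
move=> cf; have h0 : 0 <= (2^-1 : R) by rewrite invr_ge0.
have h1 : (2^-1 : R) <= 1 by lra.
have := convex_function_le x y cf h0 h1.
have -> : 1 - 2^-1 = 2^-1 :> R by lra.
by rewrite -scalerDr; lra.
Qed.

Lemma scaler_half_double (R : realType) (V : lmodType R) (x : V) :
  2^-1 *: (x + x) = x.
Proof. by rewrite -[x + x]mulr2n -[x *+ 2]scaler_nat scalerA mulVf// scale1r. Qed.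

(** Along a line, a convex function lies below its chords; this is used on both
    sides of x. *)
Lemma convex_ray_le (R : realType) (V : lmodType R) (f : V -> R) (x v : V) :
  @convex_function R V setT f ->
  exists2 C, 0 <= C &
    forall s, `|s| <= 1 -> f (x + s *: v) - f x <= C * `|s|.
Proof.
move=> cf; exists (`|f (x + v) - f x| + `|f (x - v) - f x|).
  by rewrite addr_ge0.
have half w s : 0 <= s -> s <= 1 ->
    f (x + s *: w) - f x <= s * (f (x + w) - f x).
  move=> s0 s1; have := convex_function_le (x + w) x cf s0 s1.
  rewrite scalerDr addrAC -scalerDl addrC subrKC scale1r addrC => h.
  lra.
move=> s s1; have [s0|s0] := leP 0 s.
  move: s1; rewrite ger0_norm// => s1; apply: le_trans (half v s s0 s1) _.
  by rewrite mulrC ler_wpM2r// (le_trans (ler_norm _))// lerDl.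
move: s1; rewrite ltr0_norm// => s1.
rewrite -[s *: v]opprK -scaleNr -scalerN.
have s0' : 0 <= - s by rewrite oppr_ge0 ltW.
apply: le_trans (half (- v) (- s) s0' s1) _.
by rewrite mulrC ler_wpM2r// (le_trans (ler_norm _))// lerDr.
Qed.

(** The coordinates of u are added one at a time: x + s e_j + v is the midpoint
    of x + 2 s e_j, handled by convex_ray_le, and of x + 2 v, handled by
    induction. *)
Lemma convex_local_upper_bound (R : realType) (n : nat) (f : 'rV[R]_n -> R)
    (x : 'rV[R]_n) :
  @convex_function R 'rV[R]_n setT f ->
  exists C d : R, [/\ 0 <= C, 0 < d &
    forall u : 'rV[R]_n, `|u| <= d -> f (x + u) - f x <= C * `|u|].
Proof.
move=> cf.
suff [C [d [C0 d0 H]]] : exists C d : R, [/\ 0 <= C, 0 < d &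
    forall u : 'rV[R]_n, `|u| <= d ->
      f (x + \sum_(j <- index_enum 'I_n) u 0 j *: 'e_j) - f x <= C * `|u|].
  by exists C, d; split=> // u /H; rewrite -row_sum_delta.
elim: (index_enum 'I_n) => [|j r [C [d [C0 d0 IH]]]].
  exists 0, 1; split=> [//|//|u _]; rewrite big_nil addr0 subrr mul0r//.
have [C' C'0 ray] := convex_ray_le x 'e_j cf.
(* Each step doubles u, so the radius is halved. *)
exists (C' + C), (Num.min d 1 / 2); split.
- exact: addr_ge0.
- by rewrite divr_gt0// lt_min d0 ltr01.
move=> u; rewrite ler_pdivlMr// le_min => /andP[ud u1].
have n2u : `|2 *: u| = `|u| * 2 by rewrite normrZ ger0_norm// mulrC.
have uj : `|u 0 j| <= `|u|.
  by rewrite [leRHS]mx_normrE; apply: (le_bigmax _ (fun ij => `|u ij.1 ij.2|) (0, j)).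
have := IH (2 *: u); rewrite n2u => /(_ ud) h1.
have := ray (2 * u 0 j); rewrite normrM ger0_norm//.
have uj1 : 2 * `|u 0 j| <= 1 by lra.
move=> /(_ uj1) h2.
rewrite big_cons; set v := \sum_(i <- r) _.
have e : \sum_(i <- r) (2 *: u) 0 i *: 'e_i = 2 *: v.
  rewrite scaler_sumr; apply: eq_bigr => k _.
  by rewrite mxE scalerA.
rewrite e in h1.
have := convex_midpoint_le (x + (2 * u 0 j) *: 'e_j) (x + 2 *: v) cf.
have -> : 2^-1 *: (x + (2 * u 0 j) *: 'e_j + (x + 2 *: v))
    = x + (u 0 j *: 'e_j + v).
  rewrite addrACA [LHS]scalerDr scaler_half_double -scalerA -scalerDr.
  by rewrite [2^-1 *: _]scalerA mulVf// scale1r.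
move=> h3; have : C' * `|u 0 j| <= C' * `|u| by rewrite ler_wpM2l.
move=> h4; lra.
Qed.

(** The upper bound at - u gives the lower bound at u, because x is the midpoint
    of x + u and x - u. *)
Lemma convex_continuous (R : realType) (n : nat) (f : 'rV[R]_n -> R) :
  @convex_function R 'rV[R]_n setT f -> continuous f.
Proof.
move=> cf x; have [C [d [C0 d0 ub]]] := convex_local_upper_bound x cf.
have near_x u : `|u| <= d -> `|f (x + u) - f x| <= C * `|u|.
  move=> ud; have h1 := ub _ ud.
  have := ub (- u); rewrite normrN => /(_ ud) h2.
  have := convex_midpoint_le (x + u) (x - u) cf.
  rewrite addrACA subrr addr0 scaler_half_double.
  move=> h3; rewrite ler_norml h1 andbT; lra.
apply/(@cvgrPdist_le _ _ _ (nbhs x) (nbhs_filter x)) => e e0.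
have : \forall y \near x, `|x - y| <= Num.min d (e / (C + 1)).
  apply/nbhs_normP; exists (Num.min d (e / (C + 1))); last by move=> y /ltW.
  by rewrite /= lt_min d0 divr_gt0// ltr_wpDl.
apply: filterS => y; rewrite distrC le_min => /andP[yd ye].
rewrite distrC -[y](subrKC x); apply: le_trans (near_x _ yd) _.
apply: (@le_trans _ _ ((C + 1) * `|y - x|)).
  by rewrite ler_wpM2r// lerDl.
by rewrite mulrC -ler_pdivlMr// ltr_wpDl.
Qed.

(** * The primal function and its multipliers *)

(** The best violation for a given x is the positive part of g x - y, so the
    primal problem minimizes the exact penalty f + M max(0, g - y) over X. *)
Lemma penalty_primal_values (R : realType) (n : nat) (X : set 'rV[R]_n)
    (f g : 'rV[R]_n -> R) (M y : R) (x : 'rV[R]_n) :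
  X x -> primal_values X g M f y (f x + M * Num.max 0 (g x - y)).
Proof.
move=> Xx; exists (x, Num.max 0 (g x - y)) => //; split => //=.
  by rewrite -lerBlDl le_max lexx orbT.
by rewrite le_max lexx.
Qed.

Lemma primal_has_minimum (R : realType) (n : nat) (X : set 'rV[R]_n)
    (f g : 'rV[R]_n -> R) (M y : R) :
  X !=set0 -> compact X -> continuous f -> continuous g -> 0 <= M ->
  has_minimum (primal_values X g M f y).
Proof.
move=> X0 cX cf cg M0.
have cpen : {within X, continuous (fun x => f x + M * Num.max 0 (g x - y))}.
  apply: continuous_subspaceT => x.
  apply: (@continuousD _ _ _ f); first exact: cf.
  apply: (@continuousM _ _ (cst M)); first exact: cst_continuous.
  apply: (@continuous_max _ _ (cst 0) (fun x => g x - y)).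
    exact: cst_continuous.
  by apply: (@continuousB _ _ _ g (cst y)); [exact: cg|exact: cst_continuous].
have [c cX' cmin] := compact_EVT_min X0 cX cpen.
exists (f c + M * Num.max 0 (g c - y)); split.
  exact/penalty_primal_values/set_mem.
move=> _ [[x r] /= [gx Xx r0] <-].
apply: le_trans (cmin x (mem_set Xx)) _.
by rewrite lerD2l ler_wpM2l// ge_max r0 lerBlDl.
Qed.

Lemma primal_le_penalty (R : realType) (n : nat) (X : set 'rV[R]_n)
    (f g : 'rV[R]_n -> R) (M y : R) (x : 'rV[R]_n) :
  has_minimum (primal_values X g M f y) -> X x ->
  primal X g M f y <= f x + M * Num.max 0 (g x - y).
Proof.
by move=> /minimumP[_ lb] Xx; exact/lb/penalty_primal_values.
Qed.

Lemma weak_duality (R : realType) (n : nat) (X : set 'rV[R]_n)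
    (f g : 'rV[R]_n -> R) (M y mu a : R) :
  has_minimum (primal_values X g M f y) -> 0 <= mu <= M ->
  (forall x, X x -> a <= f x + mu * (g x - y)) ->
  a <= primal X g M f y.
Proof.
move=> /minimumP[+ _] /andP[mu0 muM] ale.
rewrite -/(primal X g M f y) => -[[x r] /= [gx Xx r0] <-].
apply: le_trans (ale x Xx) _; rewrite lerD2l.
apply: (@le_trans _ _ (mu * r)); first by rewrite ler_wpM2l// lerBlDl.
exact: ler_wpM2r.
Qed.

(** A lower bound v of the exact penalty is a lower bound of some Lagrangian.
    A point with g x > y asks for mu >= (v - f x) / (g x - y), a point with
    g x < y for mu <= (f x - v) / (y - g x), and mu is taken to be the largest of
    the lower constraints, 0 included.  A lower and an upper constraint are
    compatible because the convex combination of their two points that makes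
    the interpolated constraint an equality is feasible, so that f >= v there. *)
Lemma penalty_multiplier (R : realType) (V : lmodType R) (X : set V)
    (f g : V -> R) (M y v : R) :
  @convex_set R V X -> @convex_function R V setT f ->
  @convex_function R V setT g -> 0 <= M ->
  (forall x, X x -> v <= f x + M * Num.max 0 (g x - y)) ->
  exists2 mu, 0 <= mu <= M & forall x, X x -> v <= f x + mu * (g x - y).
Proof.
move=> cX cf cg M0 pen.
pose S := [set s : R | s = 0 \/
  exists x, [/\ X x, 0 < g x - y & s = (v - f x) / (g x - y)]].
have S0 : S 0 by left.
have SM : ubound S M.
  move=> s [->//|[x [Xx gx ->]]]; rewrite ler_pdivrMr//.
  by have := pen x Xx; rewrite (max_r (ltW gx)); lra.
have supS : has_sup S by split; [exists 0|exists M].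
have feas x : X x -> g x - y <= 0 -> v <= f x.
  by move=> Xx gx; have := pen x Xx; rewrite max_l// mulr0 addr0.
exists (sup S).
  apply/andP; split; first exact: (sup_upper_bound supS).
  by apply: ge_sup => //; exists 0.
move=> x Xx; have [gx|gx|gx] := ltgtP (g x - y) 0; last first.
- by have := feas x Xx; rewrite gx lexx mulr0 addr0; apply.
- rewrite -lerBlDl -ler_pdivrMr//; apply: (sup_upper_bound supS).
  by right; exists x.
have fx := feas x Xx (ltW gx).
suff : sup S <= (f x - v) / (y - g x).
  by rewrite ler_pdivlMr; [lra|rewrite -(opprB (g x)) oppr_gt0].
have yx : 0 < y - g x by lra.
apply: ge_sup; first by exists 0.
move=> s [->|[x1 [Xx1 gx1 ->]]].
  by rewrite divr_ge0 ?subr_ge0// ltW// -subr_gt0.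
rewrite ler_pdivrMr// mulrAC ler_pdivlMr//.
set a := g x1 - y in gx1 *; set b := y - g x in yx *.
have ab : 0 < a + b by rewrite addr_gt0.
(* l a = (1 - l) b, so the combination of g x1 and g x with weight l is y. *)
pose l := b / (a + b).
have l0 : 0 <= l by rewrite divr_ge0// ltW.
have l1 : l <= 1 by rewrite ler_pdivrMr// mul1r lerDr ltW.
have Xz : X (l *: x1 + (1 - l) *: x).
  by have := cX x1 x (Itv01 l0 l1) (mem_set Xx1) (mem_set Xx); rewrite in_setE.
have := feas _ Xz.
have lE : l * (a + b) = b by rewrite divfK// gt_eqF.
have hg := convex_function_le x1 x cg l0 l1.
have hf := convex_function_le x1 x cf l0 l1.
have gz : g (l *: x1 + (1 - l) *: x) - y <= 0.
  rewrite subr_le0; apply: le_trans hg _.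
  rewrite le_eqVlt; apply/orP; left; apply/eqP.
  transitivity (l * (a + b) - b + y); last by rewrite lE; ring.
  by rewrite /a /b; ring.
move=> /(_ gz) vz.
have vle : v <= l * f x1 + (1 - l) * f x := le_trans vz hf.
have := ler_wpM2r (ltW ab) vle.
have -> : (l * f x1 + (1 - l) * f x) * (a + b)
   = l * (a + b) * f x1 + (a + b - l * (a + b)) * f x by ring.
rewrite lE; lra.
Qed.

(** The dual function is an infimum of affine functions of mu with slopes at most
    L in absolute value, hence L-Lipschitz, and attains its maximum over [0, M].
    The superlevel set of that maximum is an intersection of closed half-lines,
    so a least maximizer exists. *)
Lemma multiplierP (R : realType) (n : nat) (X : set 'rV[R]_n)
    (f g : 'rV[R]_n -> R) (M y L : R) :
  X !=set0 -> 0 <= M -> (forall x, X x -> `|g x - y| <= L) ->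
  (forall mu, mu <= M -> has_minimum (dual_values X g f mu y)) ->
  0 <= multiplier X g M f y <= M /\
  forall nu, 0 <= nu <= M -> minimum (dual_values X g f nu y) <=
    minimum (dual_values X g f (multiplier X g M f y) y).
Proof.
move=> [x0 Xx0] M0 gL hdual.
pose phi (mu : R) : R := minimum (dual_values X g f mu y).
have phi_le (mu : R) x : mu <= M -> X x -> phi mu <= f x + mu * (g x - y).
  by move=> /hdual/minimumP[_ lb] Xx; apply: lb; exists x.
have phiE (mu : R) : mu <= M -> exists2 x, X x & phi mu = f x + mu * (g x - y).
  by move=> /hdual/minimumP[[x Xx e] _]; exists x.
have L0 : 0 <= L by apply: le_trans (gL _ Xx0).
have phi_lip (mu nu : R) : mu <= M -> nu <= M -> phi mu - phi nu <= L * `|mu - nu|.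
  move=> muM nuM; have [x Xx ->] := phiE nu nuM.
  have := phi_le mu x muM Xx => h.
  apply: (@le_trans _ _ ((mu - nu) * (g x - y))); first by lra.
  apply: le_trans (ler_norm _) _; rewrite normrM mulrC.
  by rewrite ler_wpM2r// gL.
have cphi : {within `[0, M], continuous phi}.
  apply/subspace_continuousP => mu /= muI.
  apply/cvgrPdist_le => e e0; rewrite near_withinE.
  apply/nbhs_normP; exists (e / (L + 1)).
    by rewrite /= divr_gt0// ltr_wpDl.
  move=> nu /= /ltW munu nuI.
  move: muI nuI; rewrite !in_itv/= => /andP[_ muM] /andP[_ nuM].
  have le1 : L * `|mu - nu| <= e.
    apply: (@le_trans _ _ ((L + 1) * `|mu - nu|)).
      by rewrite ler_wpM2r// lerDl.
    by rewrite mulrC -ler_pdivlMr// ltr_wpDl.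
  have := phi_lip mu nu muM nuM; have := phi_lip nu mu nuM muM.
  rewrite (distrC nu) ler_norml => h1 h2; apply/andP; split; rewrite /from_subspace; lra.
have [c cI cmax] := EVT_max M0 cphi.
have inI mu : (`[0, M]%classic mu) = (0 <= mu <= M) :> Prop by rewrite /= in_itv.
have dualE mu : mu <= M -> dual X g M f mu y = (phi mu)%:E.
  by rewrite /dual => ->.
set A := argmax `[0, M] (fun mu => dual X g M f mu y).
have AE : A = `[0, M] `&` \bigcap_(x in X)
    [set mu | phi c <= f x + mu * (g x - y)].
  have cM : 0 <= c <= M by move: cI; rewrite in_itv.
  apply/seteqP; split => mu [muI H].
    split=> // x Xx /=; move: (muI); rewrite inI => /andP[mu0 muM].
    have := H c; rewrite inI => /(_ cM).
    rewrite !dualE//; last by case/andP: cM.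
    rewrite lee_fin => /le_trans; apply; exact: phi_le.
  split=> // nu nuI; move: (muI) (nuI); rewrite !inI => /andP[_ muM] /andP[_ nuM].
  rewrite !dualE// lee_fin.
  have [x Xx ->] := phiE mu muM.
  by apply: le_trans (cmax nu _) (H x Xx); rewrite -inI.
have cA : compact A.
  rewrite AE; apply: compact_closedI; first exact: segment_compact.
  apply: closed_bigI => x Xx.
  apply: (@preimage_closed _ _ (fun mu : R => f x + mu * (g x - y))
    [set r | phi c <= r]); last exact: closed_ge.
  move=> mu _; apply: cvgD; first exact: cvg_cst.
  by apply: cvgM; [exact: cvg_id|exact: cvg_cst].
have A0 : A !=set0.
  exists c; rewrite AE; split; first by rewrite inI; move: cI; rewrite in_itv.
  by move=> x Xx; apply: phi_le => //; move: cI; rewrite in_itv => /andP[].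
have minA : has_minimum A.
  have cid : {within A, continuous (@idfun R)}.
    by apply: continuous_subspaceT => x; exact: cvg_id.
  have [m mA mle] := compact_EVT_min A0 cA cid.
  exists m; split; first by rewrite -in_setE.
  by move=> a Aa; apply: mle; rewrite in_setE.
have [[+ H] _] := minimumP minA.
rewrite -/(multiplier X g M f y) in H *.
rewrite inI => mM; split=> // nu nuM.
have := H nu; rewrite inI => /(_ nuM).
case/andP: nuM => _ nuM; case/andP: (mM) => _ mM'.
by rewrite !dualE// lee_fin.
Qed.

(** * Errors in the subgradient inequality *)

(** p(y) <= q(nu, y) for some nu by strong duality for f, and
    q(nu, y) <= q'(nu, y) + d <= q'(mu, y) + d <= q(mu, y) + 2 d. *)
Lemma subgradient_gap_le (R : realType) (n : nat) (X : set 'rV[R]_n)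
    (f f' g : 'rV[R]_n -> R) (M y z mu d : R) :
  @convex_set R 'rV[R]_n X -> @convex_function R 'rV[R]_n setT f ->
  @convex_function R 'rV[R]_n setT g -> 0 <= M ->
  (forall w, has_minimum (primal_values X g M f w)) ->
  (forall nu, nu <= M -> has_minimum (dual_values X g f' nu y)) ->
  0 <= mu <= M ->
  (forall nu, 0 <= nu <= M -> minimum (dual_values X g f' nu y) <=
    minimum (dual_values X g f' mu y)) ->
  (forall x, X x -> `|f' x - f x| <= d) ->
  primal X g M f y - mu * (z - y) - d *+ 2 <= primal X g M f z.
Proof.
move=> cX cf cg M0 hp hd mu0M mumax ff'.
have [nu nu0M dual_nu] := penalty_multiplier cX cf cg M0
  (fun x Xx => primal_le_penalty (hp y) Xx).
have nuM : nu <= M by case/andP: nu0M.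
have muM : mu <= M by case/andP: mu0M.
apply: (weak_duality (hp z) mu0M) => x Xx.
have lb_nu : primal X g M f y - d <= minimum (dual_values X g f' nu y).
  have [[x1 Xx1 <-] _] := minimumP (hd nu nuM).
  by have := dual_nu x1 Xx1; have := ff' x1 Xx1; rewrite ler_norml; lra.
have ub_mu : minimum (dual_values X g f' mu y) <= f' x + mu * (g x - y).
  by have [_] := minimumP (hd mu muM); apply; exists x.
have := mumax nu nu0M; have := ff' x Xx; rewrite ler_norml => /andP[_ fx] mule.
lra.
Qed.

(** The bound is independent of f', y and z.  Evaluating the penalty at any point and
    weak duality at z reduce the claim to a bound of M max(0, L - y) + mu (y + L)
    uniform in y.  This expression is unbounded only for y < - L and for y > L, where
    optimality of mu against M and 0 forces mu = M and mu = 0. *)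
Lemma subgradient_gap_bounded (R : realType) (n : nat) (X : set 'rV[R]_n)
    (f f' g : 'rV[R]_n -> R) (M y z mu K L : R) :
  X !=set0 -> 0 <= M ->
  (forall w, has_minimum (primal_values X g M f w)) ->
  (forall nu, nu <= M -> has_minimum (dual_values X g f' nu y)) ->
  0 <= mu <= M ->
  (forall nu, 0 <= nu <= M -> minimum (dual_values X g f' nu y) <=
    minimum (dual_values X g f' mu y)) ->
  (forall x, X x -> `|f x| <= K) -> (forall x, X x -> `|g x| <= L) ->
  primal X g M f y - mu * (z - y) - (K *+ 2 + M * L *+ 4) <= primal X g M f z.
Proof.
move=> [x0 Xx0] M0 hp hd mu0M mumax fK gL.
case/andP: (mu0M) => mu0 muM.
have L0 : 0 <= L by apply: le_trans (gL _ Xx0).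
have opt nu : 0 <= nu <= M -> exists2 x, X x & (nu - mu) * (g x - y) <= 0.
  move=> nu0M; have nuM : nu <= M by case/andP: nu0M.
  have [[x Xx e] _] := minimumP (hd nu nuM); exists x => //.
  have : minimum (dual_values X g f' mu y) <= f' x + mu * (g x - y).
    by have [_] := minimumP (hd mu muM); apply; exists x.
  by have := mumax nu nu0M; rewrite -e; lra.
have key : M * Num.max 0 (L - y) + mu * (y + L) <= M * L *+ 4.
  have ML : 0 <= M * L by rewrite mulr_ge0.
  have [yL|yL] := ltP L y.
    have [|x Xx] := opt 0; first by rewrite lexx.
    have := gL x Xx; rewrite ler_norml => /andP[_ gx].
    rewrite sub0r mulNr oppr_le0 => h.
    have /eqP mu_eq0 : mu == 0.
      rewrite eq_le mu0 andbT leNgt; apply/negP => mup.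
      by move: h; rewrite pmulr_rge0//; lra.
    by rewrite mu_eq0 max_l; lra.
  rewrite max_r ?subr_ge0//.
  have [Ly|Ly] := ltP y (- L).
    have [|x Xx h] := opt M; first by rewrite M0 lexx.
    have := gL x Xx; rewrite ler_norml => /andP[gx _].
    have -> : mu = M.
      apply/eqP; rewrite eq_le muM/= leNgt; apply/negP => mup.
      by move: h; rewrite pmulr_rle0 ?subr_gt0//; lra.
    lra.
  have : M * (L - y) <= M * (L *+ 2) by rewrite ler_wpM2l//; lra.
  have : mu * (y + L) <= M * (L *+ 2).
    by apply: ler_pM => //; lra.
  lra.
apply: (weak_duality (hp z) mu0M) => x Xx.
have py : primal X g M f y <= K + M * Num.max 0 (L - y).
  apply: le_trans (primal_le_penalty (hp y) Xx0) _.
  apply: lerD; first exact: le_trans (ler_norm _) (fK _ Xx0).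
  rewrite ler_wpM2l// ge_max !le_max lexx/= lerD2r.
  by rewrite (le_trans (ler_norm _) (gL _ Xx0)) orbT.
have := fK x Xx; rewrite ler_norml => /andP[fx _].
have : mu * (- L) <= mu * g x.
  by rewrite ler_wpM2l//; have := gL x Xx; rewrite ler_norml => /andP[].
lra.
Qed.

Lemma uniform_cvg_dist_le (R : realType) (T : choiceType) (X : set T)
    (F : nat -> T -> R) (f : T -> R) :
  {uniform X, F @ \oo --> f} ->
  forall e, 0 < e -> \forall t \near \oo, forall x, X x -> `|F t x - f x| <= e.
Proof.
move=> Ff e e0.
have := Ff [set h | forall x, X x -> `|h x - f x| <= e].
apply; apply/uniform_nbhs; exists [set p | `|p.1 - p.2| < e].
split; last by move=> h /= fh x /fh; rewrite distrC => /ltW.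
exact: entourage_ball (PosNum e0).
Qed.

Lemma continuous_compact_norm_le (R : realType) (T : topologicalType)
    (X : set T) (f : T -> R) :
  compact X -> continuous f -> exists K, forall x, X x -> `|f x| <= K.
Proof.
move=> cX cf.
have /compact_bounded[K [_ bK]] : compact (f @` X).
  by apply: continuous_compact => //; exact: continuous_subspaceT.
exists (K + 1) => x Xx; apply: (bK (K + 1)); first by rewrite ltrDl.
by exists x.
Qed.

Theorem mainTheorem2 (R : realType) (N : nat) (i : 'I_N) (M : R) (hM : 0 < M)
    (n : 'I_N -> nat)
    (X : forall j : 'I_N, set 'rV[R]_(n j))
    (f g : forall j : 'I_N, 'rV[R]_(n j) -> R)
    (ft : nat -> forall j : 'I_N, 'rV[R]_(n j) -> R)
    (b : R)
    (hX0 : forall j : 'I_N, X j !=set0)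
    (hXconvex : forall j : 'I_N, convex_set (X j))
    (hXcompact : forall j : 'I_N, compact (X j))
    (hf : forall j : 'I_N, @convex_function R 'rV[R]_(n j) setT (f j))
    (hg : forall j : 'I_N, @convex_function R 'rV[R]_(n j) setT (g j))
    (hSlater : exists xbar : forall j : 'I_N, 'rV[R]_(n j),
      (forall j : 'I_N, X j (xbar j)) /\ \sum_(j < N) g j (xbar j) < b)
    (hft : forall j : 'I_N,
      {uniform X j, (fun t : nat => ft t j) @ \oo --> f j})
    (hprimal : forall (t : nat) (y : R),
      has_minimum (primal_values (X i) (g i) M (ft t i) y))
    (hdual : forall (t : nat) (mu y : R), mu <= M ->
      has_minimum (dual_values (X i) (g i) (ft t i) mu y)) :
  exists eps : nat -> R,
    [/\ forall t : nat, 0 <= eps t,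
        forall (t : nat) (y z : R),
          primal (X i) (g i) M (f i) y
            + (z - y) * subderivative (X i) (g i) M (ft t i) y - eps t
          <= primal (X i) (g i) M (f i) z
      & eps @ \oo --> (0 : R)].
Proof.
have M0 := ltW hM.
have cf := convex_continuous (hf i); have cg := convex_continuous (hg i).
have [K fK] := continuous_compact_norm_le (hXcompact i) cf.
have [L gL] := continuous_compact_norm_le (hXcompact i) cg.
have hp y := primal_has_minimum y (hX0 i) (hXcompact i) cf cg M0.
have hmu t y := multiplierP (hX0 i) M0 (L := L + `|y|)
  (fun x Xx => le_trans (ler_normB (g i x) y) (lerD (gL x Xx) (lexx `|y|)))
  (fun mu => hdual t mu y).
(* The amount by which the subgradient inequality at y fails at z. *)
pose gap t y z := primal (X i) (g i) M (f i) y
  - multiplier (X i) (g i) M (ft t i) y * (z - y) - primal (X i) (g i) M (f i) z.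
(* The element 0 makes the supremum non-negative. *)
pose S t := [set r | r = 0 \/ exists y z, r = gap t y z].
have S0 t : S t 0 by left.
have gapS t y z : S t (gap t y z) by right; exists y, z.
have ubS t e : 0 <= e -> (forall y z, gap t y z <= e) -> ubound (S t) e.
  by move=> e0 ge r [->//|[y [z ->]]].
have supS t : has_sup (S t).
  split; first by exists 0.
  have [x0 Xx0] := hX0 i.
  have K0 := le_trans (normr_ge0 _) (fK x0 Xx0).
  have L0 := le_trans (normr_ge0 _) (gL x0 Xx0).
  exists (K *+ 2 + M * L *+ 4); apply: ubS.
    by rewrite addr_ge0// mulrn_wge0// mulr_ge0.
  move=> y z; have [mu0M mumax] := hmu t y.
  have := subgradient_gap_bounded z (hX0 i) M0 hp (fun mu => hdual t mu y)
    mu0M mumax fK gL.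
  by rewrite /gap; lra.
exists (fun t => sup (S t)); split.
- by move=> t; exact: (sup_upper_bound (supS t)).
- move=> t y z; have := sup_upper_bound (supS t) (gapS t y z).
  by rewrite /gap /subderivative; lra.
apply/cvgrPdist_le => e e0.
have := uniform_cvg_dist_le (hft i) (e := e / 2).
rewrite divr_gt0// => /(_ isT); apply: filterS => t ht.
rewrite sub0r normrN ger0_norm; last exact: (sup_upper_bound (supS t)).
apply: ge_sup; first by exists 0.
apply: ubS => [|y z]; first exact: ltW.
have [mu0M mumax] := hmu t y.
have := subgradient_gap_le z (hXconvex i) (hf i) (hg i) M0 hp
  (fun mu => hdual t mu y) mu0M mumax ht.
by rewrite /gap; lra.
Qed.
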